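(* Let $q$ be a prime and let $G$ be a $q^*$-group of order $n$ (that is, $G$ is a finite group of order $n$ and $q$ is the least prime divisor of $n$). Then $G$ is a second maximal $q^*$-group, i.e. $$\psi(G)=\frac{((q^2-1)q+1)(q+1)}{q^5+1}\,\psi(C_n),$$ if and only if $n=q^2k$ for some positive integer $k$ with $(k,q!)=1$ and $G\cong (C_q\times C_q)\times C_k$.
   Context: All groups are finite. For a finite group $G$, $\psi(G)=\sum_{x\in G} o(x)$, where $o(x)$ denotes the order of the element $x$. $C_m$ denotes the cyclic group of order $m$. $(a,b)$ denotes the greatest common divisor of the integers $a,b$, and $q!$ is the factorial of $q$. For a prime $q$, a group $G$ is called a $q^*$-group if $q$ is the least prime divisor of the order of $G$. A $q^*$-group $G$ of order $n$ is called a second maximal $q^*$-group if $\psi(G)=f(q)\psi(C_n)$, where $f(x)=\frac{((x^2-1)x+1)(x+1)}{x^5+1}$. *)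

(* Defs.v *)
From mathcomp Require Import all_boot all_order all_algebra all_fingroup.

Set Implicit Arguments.
Unset Strict Implicit.
Unset Printing Implicit Defensive.

Import GRing.Theory.

Local Open Scope group_scope.

Definition psi (gT : finGroupType) (G : {set gT}) : nat :=
  (\sum_(x in G) #[x])%N.

(* The additive group of integers mod n.  The carrier 'Z_n has two elements
   when n = 1, but Zp 1 is its trivial subgroup, so Cyc n has order n for all
   n > 0. *)
Definition Cyc (n : nat) : {group 'Z_n} := Zp_group n.

(* For prime q, the equality forces #|G| > 1, since pdiv 1 = 1. *)
Definition qstar_group (q : nat) (gT : finGroupType) (G : {group gT}) : Prop :=
  pdiv #|G| = q.

Definition fratio (x : rat) : rat :=
  (((x ^+ 2 - 1) * x + 1) * (x + 1) / (x ^+ 5 + 1))%R.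

Definition second_maximal_qstar (q : nat) (gT : finGroupType)
    (G : {group gT}) : Prop :=
  qstar_group q G /\
  ((psi G)%:R = fratio q%:R * (psi (Cyc #|G|))%:R :> rat)%R.

(* Main.v *)
Require Import Defs.
From mathcomp Require Import all_boot all_order all_algebra all_fingroup.
From mathcomp Require Import all_solvable.
From mathcomp Require Import zify ring.

(** Write n for the order of G, q for its least and p for its largest prime
    divisor, and f(q) for the ratio of the statement.  Since
    psi(C_(q^2)) = (q^5 + 1) / (q + 1) and psi(C_q x C_q) = (q^2 - 1) q + 1,
    the number f(q) is psi(C_q x C_q) / psi(C_(q^2)); as psi is multiplicative
    on direct products of coprime orders, the groups (C_q x C_q) x C_k with k
    prime to q do satisfy the equality.  A cyclic G does not, because
    f(q) < 1.  What has to be shown is that f(q) psi(C_n) <= psi(G) forces a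
    noncyclic G to be such a product ([large_psi_noncyclic]).  The inequality,
    rather than the equality, is what an induction on n needs.

    If p = q, then G is a q-group without elements of order n.  If it has
    an element x of order n / q, the elements of <x^q> have smaller orders
    still, and this is enough to make psi(G) too small unless n = q^2; without
    such an x, psi(G) is smaller yet ([large_psi_pgroup]).

    If q < p, a telescoping product over the primes between q and p gives
    q n^2 <= (p + 1) psi(C_n) ([psi_Cyc_lower]).  As f(q) exceeds 1 / q, the
    mean order psi(G) / n exceeds n / (p + 1), and some cyclic subgroup has
    index at most p; a finer estimate excludes the index p
    ([large_psi_cyclic_index]).  The cyclic subgroup contains a Sylow p-subgroup
    P and normalises it, so that P has fewer than p conjugates and is normal
    ([cyclic_normal_Sylow]).  Hence G is a semidirect product of the cyclic
    group P and a p'-group H.  An element h of H not centralising P acts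
    without fixed points on P, so that all of the coset Ph is conjugate to h,
    and

      psi(G) = psi(P) psi(C) + |P| (psi(H) - psi(C)),   C = C_H(P)

    ([psi_cyclic_pgroup_sdprod]).  This is at most psi(P) psi(H), with equality
    only for C = H.  If H is not cyclic, the induction hypothesis applies to
    it, and equality holds throughout: H centralises P and G = P x H has the
    required form.  If H is cyclic, C is a proper subgroup of H since G is not
    cyclic; this makes psi(C) / psi(H) at most 1 / (q^2 - q + 1), and the
    formula gives psi(G) < f(q) psi(C_n) ([psi_noncentral_cyclic_sdprod]). *)

Local Open Scope group_scope.

Section SumsOfOrders.

Set Implicit Arguments.
Unset Strict Implicit.

Local Open Scope nat_scope.

(** * Polynomial inequalities *)

(** Numerator and denominator of f(q).  Inequalities in them are reduced, by
    substituting t + 2 for q, to polynomial identities in which the difference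
    of the two sides visibly has nonnegative coefficients. *)
Definition ratio_num q := ((q ^ 2 - 1) * q + 1) * (q + 1).
Definition ratio_den q := q ^ 5 + 1.

Lemma sqrnB_id m : m ^ 2 - m = m * m.-1.
Proof. by rewrite -mulnn -[X in _ - X]muln1 -mulnBr subn1. Qed.

Lemma ratio_numE t :
  ratio_num t.+2 = ((t * t + 4 * t + 3) * t.+2 + 1) * t.+3.
Proof.
by rewrite /ratio_num addn1 (_ : t.+2 ^ 2 - 1 = t * t + 4 * t + 3) //; lia.
Qed.

Lemma ratio_denE t :
  ratio_den t.+2 = ratio_num t.+2 + t.+1 ^ 2 * t.+3 * t.+2 ^ 2.
Proof. by rewrite ratio_numE /ratio_den; ring. Qed.

Lemma ratio_num_lt_den q : 1 < q -> ratio_num q < ratio_den q.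
Proof.
case: q => [|[|t]] // _; rewrite ratio_denE.
have : 0 < t.+1 ^ 2 * t.+3 * t.+2 ^ 2 by rewrite !muln_gt0.
by move: (ratio_num _) (_ * _) => x y; clear; lia.
Qed.

(** Here N stands for p^(2a - 4), c for psi(C_(p^a)), d for psi(C_(p^(a - 2)))
    and s for psi(G), where G has order p^a and elements of order p^(a - 1):
    for a > 2 the two bounds on s contradict each other. *)
Lemma ratio_pgroup_square p N c d s : 1 < p -> 0 < N ->
    c * p.+1 = p ^ 5 * N + 1 -> d * p.+1 = p * N + 1 ->
    ratio_num p * c <= ratio_den p * s ->
  s <= d + (p ^ 2 - 1) * p * N -> N = 1.
Proof.
case: p => [|[|t]] // _; case: N => // M _.
rewrite (_ : t.+2 ^ 2 - 1 = t * t + 4 * t + 3); last by lia.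
rewrite ratio_numE /ratio_den => c_def d_def large_s le_s.
have h1 := leq_mul (leqnn (t.+2 ^ 5 + 1)) (leq_mul le_s (leqnn t.+3)).
rewrite [(d + _) * _]mulnDl d_def in h1.
have h2 : (((t * t + 4 * t + 3) * t.+2 + 1) * t.+3) * (t.+2 ^ 5 * M.+1 + 1)
    <= (t.+2 ^ 5 + 1) * (s * t.+3).
  by rewrite -c_def; have := leq_mul large_s (leqnn t.+3); lia.
have : t.+3 * M * t.+2 ^ 2 * t.+1 ^ 2 <= 0.
  by move: (leq_trans h2 h1); clear; lia.
by rewrite leqn0 !muln_eq0 /= !orbF => /eqP ->.
Qed.

(** With the same reading of N, c and s, this excludes groups of order p^a
    whose elements all have order at most p^(a - 2). *)
Lemma ratio_pgroup_lt p N c s : 1 < p -> 0 < N ->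
    c * p.+1 = p ^ 5 * N + 1 ->
    ratio_num p * c <= ratio_den p * s -> p ^ 2 * N < s.
Proof.
case: p => [|[|t]] // _; case: N => // M _.
rewrite ratio_numE /ratio_den => c_def large_s.
have h2 : ((t * t + 4 * t + 3) * t.+2 + 1) * (t.+2 ^ 5 * M.+1 + 1)
    <= (t.+2 ^ 5 + 1) * s.
  by rewrite -c_def; lia.
rewrite ltnNge; apply/negP => h3.
by move: (leq_trans h2 (leq_mul (leqnn (t.+2 ^ 5 + 1)) h3)); clear; lia.
Qed.

(** With n the order of G, c = psi(C_n) and s = psi(G), the conclusion says that
    the mean order of an element of G exceeds n / p.  The only distinct primes
    q < p left out are 2 and 3, for which the hypotheses give too little. *)
Lemma ratio_mean_order q p n c s : 1 < q -> q.+2 <= p -> 0 < n ->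
    q * n ^ 2 <= p.+1 * c -> ratio_num q * c <= ratio_den q * s ->
  n ^ 2 < p * s.
Proof.
case: q => [|[|t]] // _ lt_qp.
rewrite -(subnK lt_qp); move: (p - _) => r n_gt0 lower large_s.
rewrite ltnNge; apply/negP => le_n2; rewrite /ratio_den in large_s.
move: (ratio_numE t) large_s; move: (ratio_num t.+2) => num num_def large_s.
have h1 := leq_mul (leqnn ((r + t.+4) * num)) lower.
have h2 := leq_mul (leqnn ((r + t.+4) * (r + t.+4).+1)) large_s.
have h3 := leq_mul (leqnn ((r + t.+4).+1 * (t.+2 ^ 5 + 1))) le_n2.
have : (r + t.+4) * num * t.+2 * n ^ 2
    <= (r + t.+4).+1 * (t.+2 ^ 5 + 1) * n ^ 2.
  by lia.
rewrite leq_pmul2r ?expn_gt0 ?n_gt0 // leqNgt => /negP; apply.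
have -> : (r + t.+4) * num * t.+2 = (r + t.+4).+1 * (t.+2 ^ 5 + 1)
  + (t ^ 4 + 6 * t ^ 3 + 13 * t ^ 2 + 13 * t + 3 + r * t.+1 * (t.+2 ^ 3 + 1)).
  by rewrite num_def; ring.
by move: (_.+1 * _) (r * _ * _) => x y; clear; lia.
Qed.

(** The function p / (p^2 - p + 1) is decreasing, and its value at q + 1 is
    (q + 1) / (q^2 + q + 1). *)
Lemma quotient_bound_mono q p A B : q < p -> B * (p ^ 2 - p + 1) <= p * A  ->
  (q ^ 2 + q + 1) * B <= q.+1 * A.
Proof.
move=> lt_qp; rewrite -(subnK lt_qp); move: (p - _) => t.
have -> : (t + q.+1) ^ 2 - (t + q.+1) + 1 = (t + q.+1) * (t + q) + 1.
  by rewrite sqrnB_id [in X in _ * X]addnS.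
move=> /(leq_mul (leqnn q.+1)) h.
rewrite -(@leq_pmul2l (t + q.+1)) ?addn_gt0 ?orbT //.
apply: leq_trans (_ : q.+1 * (B * ((t + q.+1) * (t + q) + 1)) <= _); last by lia.
have -> : q.+1 * (B * ((t + q.+1) * (t + q) + 1)) =
    (t + q.+1) * ((q ^ 2 + q + 1) * B) + t * (q ^ 2 + t * q + t + q + q) * B.
  by ring.
exact: leq_addr.
Qed.

(** Here A = psi(P), B = |P|, h = psi(H) and c = psi(C_H(P)) for a semidirect
    product of cyclic groups P and H.  Both quotient bounds are equalities for
    the symmetric group of degree 3, with q = 2, |P| = 3 and |H| = 2. *)
Lemma ratio_metacyclic q A B h c : 1 < q -> 0 < h -> B <= A -> 0 < A ->
    (q ^ 2 + q + 1) * B <= q.+1 * A -> c * (q ^ 2 - q + 1) <= h ->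
  ratio_den q * (h * B + c * (A - B)) < ratio_num q * (A * h).
Proof.
case: q => [|[|t]] // _.
have -> : t.+2 ^ 2 - t.+2 + 1 = t * t + 3 * t + 3 by lia.
move=> h_gt0 /subnK; move: (A - B) => D <- A_gt0 hB hc.
have {}hB : t.+2 ^ 2 * B <= t.+3 * D by lia.
have D_gt0 : 0 < D by nia.
set num := ratio_num _; set den := ratio_den _.
set d := t * t + 3 * t + 3 in hc *.
have den_def : den = num + t.+1 ^ 2 * t.+3 * t.+2 ^ 2 by apply: ratio_denE.
pose u := t.+3 * t.+1 * t.+2 * (t.+2 ^ 2 * t.+1 + 1).
have num_def : num * d = den + u.
  by rewrite /num ratio_numE /d /den /ratio_den /u; ring.
have lt_u : t.+1 ^ 2 * t.+3 * (t.+3 * D) * d < u * D.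
  have -> : u * D = t.+1 ^ 2 * t.+3 * (t.+3 * D) * d + t.+1 * t.+3 * D.
    by rewrite /u /d; ring.
  have : 0 < t.+1 * t.+3 * D by rewrite !muln_gt0.
  by move: (t.+1 * _ * D) (_ * d) => x y; clear; lia.
(* The goal with c replaced by its largest value h / d, times d / h. *)
have h1 : den * (d * B + D) < num * d * (D + B).
  have := leq_mul (leqnn (t.+1 ^ 2 * t.+3 * d)) hB.
  have -> : den * (d * B + D) =
    num * d * B + t.+1 ^ 2 * t.+3 * d * (t.+2 ^ 2 * B) + den * D.
    by rewrite mulnDr; congr (_ + _); rewrite den_def; ring.
  rewrite [num * d * (D + B)]mulnDr {2}num_def mulnDl.
  move: lt_u; rewrite [_ * d in X in X -> _]mulnAC.
  move: (u * D) (den * D) (num * d * B) (_ * (_ * B)) (_ * (_ * D)).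
  by clear; lia.
rewrite -(@ltn_pmul2l d) ?addn_gt0 ?orbT //.
have h2 := leq_mul (leqnn (den * D)) hc.
have : h * (den * (d * B + D)) < h * (num * d * (D + B)) by rewrite ltn_pmul2l.
by move: h2; clear; move: num den d => num den d; lia.
Qed.

(** * Sums of element orders *)

Implicit Type gT rT : finGroupType.

Lemma psi_gt0 gT (G : {group gT}) : 0 < psi G.
Proof. by rewrite /psi (bigD1 1%g) //= order1. Qed.

Lemma psi_isog gT rT (G : {group gT}) (H : {group rT}) :
  G \isog H -> psi G = psi H.
Proof.
case/isogP=> f injf <-; rewrite /psi morphimEdom big_imset /=; last first.
  exact: (injmP injf).
by apply: eq_bigr => x Gx; rewrite order_injm.
Qed.

Lemma psi_sdprod gT (G K H : {group gT}) :
  K ><| H = G -> psi G = \sum_(h in H) \sum_(u in K) #[u * h].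
Proof.
case/sdprodP=> _ defG nKH tiKH; rewrite /psi -defG exchange_big pair_big /=.
rewrite (reindex_onto (fun p : gT * gT => (p.1 * p.2)%g)
  (fun x => (divgr K H x, remgr K H x))) /=; last first.
  by move=> x _; rewrite -divgr_eq.
apply: eq_bigl => -[u h] /=; apply/andP/andP=> [[KHuh /eqP[eu eh]]|[Ku Hh]].
  by split; [rewrite -eu mem_divgr | rewrite -eh mem_remgr].
by rewrite mem_mulg // divgrMid ?remgrMid.
Qed.

Lemma psi_dprod gT (G K H : {group gT}) :
  K \x H = G -> coprime #|K| #|H| -> psi G = psi K * psi H.
Proof.
move=> defG coKH; have [_ _ cKH _] := dprodP defG.
rewrite (psi_sdprod (dprodWsd defG)) exchange_big /psi big_distrlr /=.
apply: eq_bigr => u Ku; apply: eq_bigr => h Hh; apply: orderM.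
  exact: commute_sym (centsP cKH h Hh u Ku).
exact: coprime_dvdl (order_dvdG Ku) (coprime_dvdr (order_dvdG Hh) coKH).
Qed.

Lemma psi_setD gT (G S : {group gT}) :
  S \subset G -> psi G = psi S + \sum_(x in G :\: S) #[x].
Proof.
move=> sSG; rewrite /psi (bigID [in S]) /=; congr (_ + _); apply: eq_bigl => x.
  by apply: andb_idl => /(subsetP sSG).
by rewrite inE andbC.
Qed.

Lemma psi_le_subgroup gT (G S : {group gT}) m :
    S \subset G -> {in G, forall x, #[x] <= m} ->
  psi G <= psi S + (#|G| - #|S|) * m.
Proof.
move=> sSG le_m; rewrite (psi_setD sSG) leq_add2l -cardsDS // -sum_nat_const.
by apply: leq_sum => x /setDP[Gx _]; apply: le_m.
Qed.

Lemma psi_le gT (G : {group gT}) m :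
  {in G, forall x, #[x] <= m} -> psi G <= #|G| * m.
Proof. by move=> le_m; rewrite -sum_nat_const; apply: leq_sum. Qed.

Lemma card_lt_psi gT (G : {group gT}) : G :!=: 1%g -> #|G| < psi G.
Proof.
case/trivgPn=> x Gx ntx.
rewrite /psi -sum1_card (bigD1 x) // [X in _ < X](bigD1 x) //=.
rewrite -addSn leq_add ?order_gt1 //.
by apply: leq_sum => y _; apply: order_gt0.
Qed.

Lemma psi_subset gT (H C : {group gT}) : C \subset H -> psi C <= psi H.
Proof. by move=> sCH; rewrite (psi_setD sCH) leq_addr. Qed.

(** * The sum for a cyclic group *)

Lemma isog_setX_trivial gT rT (A : {group gT}) (B : {group rT}) :
  A \isog setX A (1%G : {group rT}) /\ B \isog setX (1%G : {group gT}) B.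
Proof. by split; [apply: isog_setX1 | apply: isog_set1X]. Qed.

Lemma cyclic_Cyc n : cyclic (Cyc n).
Proof.
rewrite /Cyc /= /Zp; case: ifP => _; last exact: cyclic1.
by apply/cyclicP; exists Zp1; rewrite -Zp_cycle.
Qed.

Lemma psi_cyclic gT (G : {group gT}) : cyclic G -> psi G = psi (Cyc #|G|).
Proof.
move=> cycG; apply: psi_isog.
by rewrite isog_cyclic_card // cyclic_Cyc card_Zp /=.
Qed.

Lemma psi_Cyc_coprime m n : 0 < m -> 0 < n -> coprime m n ->
  psi (Cyc (m * n)) = psi (Cyc m) * psi (Cyc n).
Proof.
move=> m_gt0 n_gt0 co_mn.
have defX := setX_dprod (Cyc m) (Cyc n).
have [iso1 iso2] := isog_setX_trivial (Cyc m) (Cyc n).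
have cX : cyclic (setX (Cyc m) (Cyc n)).
  rewrite (cyclic_dprod defX) -?(isog_cyclic iso1) -?(isog_cyclic iso2);
    rewrite ?cyclic_Cyc //.
  by rewrite -(card_isog iso1) -(card_isog iso2) !card_Zp.
rewrite (psi_isog iso1) (psi_isog iso2) -(psi_dprod defX); last first.
  by rewrite -(card_isog iso1) -(card_isog iso2) !card_Zp.
by rewrite (psi_cyclic cX) cardsX !card_Zp.
Qed.

(** The elements of a cyclic p-group outside its maximal subgroup generate it. *)
Lemma psi_cycle_primepow gT (x : gT) p a :
    prime p -> #[x] = p ^ a.+1 ->
  psi <[x]> = psi <[x ^+ p]> + (p ^ a.+1 - p ^ a) * p ^ a.+1.
Proof.
move=> p_pr ox; have sxpx : <[x ^+ p]> \subset <[x]> by rewrite cycleX.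
have oxp : #[x ^+ p] = p ^ a.
  by rewrite orderXdiv ox expnS ?dvdn_mulr // mulKn ?prime_gt0.
rewrite (psi_setD sxpx); congr (_ + _).
rewrite -{1}ox -oxp -cardsDS // -sum_nat_const; apply: eq_bigr => y.
case/setDP=> /cycleP[i ->] not_xp.
suff co_xi : coprime #[x] i by rewrite orderXgcd (eqP co_xi) divn1.
rewrite ox coprime_pexpl // prime_coprime //.
by apply: contra not_xp => /dvdnP[j ->]; rewrite mulnC expgM mem_cycle.
Qed.

(** A geometric sum, by induction along the chain of subgroups. *)
Lemma psi_Cyc_primepow p a :
  prime p -> psi (Cyc (p ^ a)) * p.+1 = p ^ (2 * a).+1 + 1.
Proof.
move=> p_pr; have p_gt0 := prime_gt0 p_pr; elim: a => [|a IHa].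
  suff -> : psi (Cyc (p ^ 0)) = 1 by rewrite mul1n muln0 expn1 addn1.
  by rewrite /psi /Cyc /= /Zp big_set1 order1.
have /cyclicP[x defC] := cyclic_Cyc (p ^ a.+1).
have ox : #[x] = p ^ a.+1 by rewrite orderE -defC card_Zp ?expn_gt0 ?p_gt0.
rewrite [psi _](_ : _ = psi <[x]>); last by rewrite -defC.
rewrite (psi_cycle_primepow p_pr ox) psi_cyclic ?cycle_cyclic // -orderE.
rewrite orderXdiv ox expnS ?dvdn_mulr // mulKn // mulnDl IHa.
have -> : p ^ (2 * a.+1).+1 = p ^ 3 * p ^ (2 * a).
  by rewrite -expnD; congr (_ ^ _); lia.
have -> : p ^ (2 * a).+1 = p * p ^ (2 * a) by rewrite expnS.
have -> : p * p ^ a - p ^ a = p.-1 * p ^ a by rewrite -subn1 mulnBl mul1n.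
rewrite mulnC mul2n -addnn expnD.
case: p p_gt0 {p_pr IHa x defC ox} => // p _ /=; set N := _ ^ a.
ring.
Qed.

(** For a prime r, psi(C_(r^a)) is at least r^(2a) r / (r + 1).  The product of
    the factors r / (r + 1) over the prime divisors r of n is at least the
    product over all integers from q to p, which telescopes to q / (p + 1).
    The bounds q and p need not be primes, which lets p decrease by one in the
    induction. *)
Lemma psi_Cyc_lower q p n : 0 < q -> q <= p.+1 -> 0 < n ->
    (forall r, r \in \pi(n) -> q <= r <= p) ->
  q * n ^ 2 <= p.+1 * psi (Cyc n).
Proof.
move=> q_gt0.
have empty m r : q = r.+1 -> 0 < m -> (forall s, s \in \pi(m) -> q <= s <= r) ->
    q * m ^ 2 <= r.+1 * psi (Cyc m).
  move=> q_def m_gt0 pi_m; have [m_gt1|m_lt1|<-] := ltngtP 1 m; first 1 last.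
  - by lia.
  - by rewrite exp1n q_def leq_mul2l psi_gt0 orbT.
  by have := pi_m (pdiv m); rewrite pi_pdiv m_gt1 => /(_ isT); lia.
elim: p n => [|p IHp] n; rewrite leq_eqVlt => /predU1P[q_def|lt_qp];
  try exact: empty q_def.
  by lia.
move=> n_gt0 pi_n.
have [p_n|not_p_n] := boolP (p.+1 \in \pi(n)); last first.
  apply: (leq_trans (IHp n lt_qp n_gt0 _)); last by rewrite leq_mul2r leqnSn orbT.
  move=> r r_n; have /andP[-> /=] := pi_n r r_n.
  by rewrite leq_eqVlt => /predU1P[r_p|//]; rewrite -r_p r_n in not_p_n.
have s_pr : prime p.+1 by move: p_n; rewrite mem_primes => /andP[].
have [m ndvd defn] := pfactor_coprime s_pr n_gt0.
set a := logn _ _ in defn.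
have m_gt0 : 0 < m by move: n_gt0; rewrite defn; case: (m).
have sa_gt0 : 0 < p.+1 ^ a by rewrite expn_gt0.
have pi_m r : r \in \pi(m) -> q <= r <= p.
  move=> r_m; have dv_mn : m %| n by rewrite defn dvdn_mulr.
  have /andP[-> /=] := pi_n r (pi_of_dvd dv_mn n_gt0 r_m).
  rewrite leq_eqVlt => /predU1P[r_p|//].
  by move: r_m ndvd; rewrite r_p mem_primes prime_coprime // => /and3P[_ _ ->].
have IHm := IHp m lt_qp m_gt0 pi_m.
have co : coprime m (p.+1 ^ a) by rewrite coprime_sym coprimeXl.
rewrite defn psi_Cyc_coprime //.
have Ca := psi_Cyc_primepow a s_pr.
have -> : (m * p.+1 ^ a) ^ 2 = m ^ 2 * p.+1 ^ (2 * a).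
  by rewrite expnMn -expnM [a * 2]mulnC.
rewrite expnS in Ca.
set A := psi (Cyc (p.+1 ^ a)) in Ca *; set M := psi (Cyc m) in IHm *.
set N := p.+1 ^ (2 * a) in Ca *; rewrite -(leq_pmul2l (ltn0Sn p)).
have H : p.+1 * N <= A * p.+2 by lia.
have := leq_mul IHm H; lia.
Qed.

Lemma psi_Cyc_step r a q : prime r -> q <= r ->
  psi (Cyc (r ^ a)) * (q ^ 2 - q + 1) <= psi (Cyc (r ^ a.+1)).
Proof.
move=> r_pr le_qr; have r_gt0 := prime_gt0 r_pr.
apply: (@leq_trans (psi (Cyc (r ^ a)) * (r ^ 2 - r + 1))).
  by rewrite leq_mul2l leq_add2r !sqrnB_id leq_mul ?orbT // -!subn1 leq_sub2r.
rewrite -(leq_pmul2r (ltn0Sn r)) mulnAC !psi_Cyc_primepow //.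
have -> : r ^ (2 * a.+1).+1 = r ^ 2 * r ^ (2 * a).+1.
  by rewrite -expnD; congr (_ ^ _); lia.
have : r <= r ^ (2 * a).+1 by rewrite expnS leq_pmulr // expn_gt0 r_gt0.
case: r r_gt0 {r_pr le_qr} => // r _; move: (_ ^ (2 * a).+1) => N.
rewrite sqrnB_id /=; move=> /(leq_mul (leqnn r)); lia.
Qed.

(** Passing to the subgroup of prime index r shrinks the r-part of the order,
    where the quotient of the sums is at least r^2 - r + 1. *)
Lemma psi_proper_cyclic gT (H C : {group gT}) q :
    cyclic H -> C \proper H -> (forall r, r \in \pi(#|H|) -> q <= r) ->
  psi C * (q ^ 2 - q + 1) <= psi H.
Proof.
move=> cycH /andP[sCH not_sHC] pi_q.
have ind_gt1 : 1 < #|H : C| by rewrite indexg_gt1.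
set r := pdiv #|H : C|; have r_pr : prime r := pdiv_prime ind_gt1.
have r_H : r %| #|H| := dvdn_trans (pdiv_dvd _) (dvdn_indexg _ _).
have [x defH] := cyclicP cycH; have oH : #|H| = #[x] by rewrite defH.
set M := <[x ^+ r]>%G.
have sMH : M \subset H by rewrite defH cycleX.
have oM : #|M| = #|H| %/ r by rewrite -[LHS]orderE orderXdiv -oH.
have sCM : C \subset M.
  rewrite -(cardSg_cyclic cycH) // oM -(Lagrange sCH) -muln_divA ?pdiv_dvd //.
  exact: dvdn_mulr.
apply: leq_trans (_ : psi M * (q ^ 2 - q + 1) <= _).
  by rewrite leq_mul2r psi_subset ?orbT.
have [m ndvd oHm] := pfactor_coprime r_pr (cardG_gt0 H).
have : 0 < logn r #|H| by rewrite logn_gt0 mem_primes r_pr cardG_gt0.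
case: (logn _ _) oHm => // a oHm _.
have r_gt0 := prime_gt0 r_pr; have ra_gt0 b : 0 < r ^ b by rewrite expn_gt0 r_gt0.
have m_gt0 : 0 < m by have := cardG_gt0 H; rewrite oHm; case: (m).
have com b : coprime m (r ^ b) by rewrite coprime_sym coprimeXl.
have oMm : #|M| = m * r ^ a by rewrite oM oHm expnS mulnCA mulKn.
rewrite (psi_cyclic cycH) (psi_cyclic (cycle_cyclic _)) -/M oMm oHm.
rewrite !psi_Cyc_coprime // -mulnA leq_mul2l psi_Cyc_step ?orbT //.
by apply: pi_q; rewrite mem_primes r_pr cardG_gt0.
Qed.

Lemma card_le_psi_cyclic_pgroup gT (P : {group gT}) p :
    prime p -> p.-group P -> cyclic P -> P :!=: 1%g ->
  #|P| * (p ^ 2 - p + 1) <= p * psi P.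
Proof.
move=> p_pr pP cycP ntP; have p_gt0 := prime_gt0 p_pr.
have [[|a] oP] := p_natP pP; first by case/eqP: ntP; apply: card1_trivg.
have psiP : psi P * p.+1 = p ^ (2 * a.+1).+1 + 1.
  by rewrite psi_cyclic // oP psi_Cyc_primepow.
rewrite -(leq_pmul2r (ltn0Sn p)) -[p * psi P * _]mulnA psiP oP sqrnB_id.
have -> : p ^ (2 * a.+1).+1 = p ^ 3 * (p ^ a * p ^ a).
  by rewrite -!expnD; congr (_ ^ _); lia.
have : 0 < p ^ a by rewrite expn_gt0 p_gt0.
rewrite expnS; move: (p ^ a) => [|M] // _.
case: p p_gt0 {p_pr pP psiP oP} => // r _ /=.
have -> : r.+1 * (r.+1 ^ 3 * (M.+1 * M.+1) + 1) =
  r.+1 * M.+1 * (r.+1 * r + 1) * r.+2 +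
  (r.+1 ^ 4 * M * M + (r ^ 4 + 4 * r ^ 3 + 6 * r ^ 2 + 3 * r) * M) by ring.
exact: leq_addr.
Qed.

(** * Groups of prime power order *)

(** The inequality f(q) psi(C_n) <= psi(G), without denominators. *)
Definition large_psi q gT (G : {group gT}) :=
  ratio_num q * psi (Cyc #|G|) <= ratio_den q * psi G.

Lemma cyclic_order gT (G : {group gT}) x : x \in G -> #[x] = #|G| -> cyclic G.
Proof.
move=> Gx ox; apply/cyclicP; exists x; apply/esym/eqP.
by rewrite eqEcard cycle_subG Gx -orderE ox leqnn.
Qed.

(** A noncyclic group of order p^a has no element of order p^a.  If x has order
    p^(a - 1), the p^(a - 2) elements of <x^p> are counted exactly and the other
    ones are given order p^(a - 1); this yields equality for a = 2, and too
    small a sum for a > 2.  If there is no such x, the bound p^(2a - 2) on the sum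
    is too small as well. *)
Lemma large_psi_pgroup gT (G : {group gT}) p :
    prime p -> p.-group G -> ~~ cyclic G -> large_psi p G ->
  p.-abelem G /\ #|G| = p ^ 2.
Proof.
move=> p_pr pG ncG largeG; have p_gt1 := prime_gt1 p_pr.
have p_gt0 := prime_gt0 p_pr.
have [b oG] : exists b, #|G| = p ^ b.+2.
  have [[|[|b]] oG] := p_natP pG; last by exists b.
    by case/negP: ncG; apply: dvdn_prime_cyclic p_pr _; rewrite oG dvd1n.
  by case/negP: ncG; apply: prime_cyclic; rewrite oG.
have le_ord x : x \in G -> exists2 i, i < b.+2 & #[x] = p ^ i.
  move=> Gx; have := order_dvdG Gx; rewrite oG => /(dvdn_pfactor _ _ p_pr)[i].
  rewrite leq_eqVlt => /predU1P[->|lt_i] ox; last by exists i.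
  by case/negP: ncG; apply: cyclic_order Gx _; rewrite oG.
have b0 : b = 0.
  have := psi_Cyc_primepow b.+2 p_pr; move: largeG.
  rewrite /large_psi /ratio_num /ratio_den oG.
  have -> : p ^ (2 * b.+2).+1 = p ^ 5 * (p ^ b) ^ 2.
    by rewrite -expnM -expnD; congr (_ ^ _); lia.
  set c := psi _ => largeG c_def.
  have Q_gt0 : 0 < p ^ b by rewrite expn_gt0 p_gt0.
  have [/exists_inP[x Gx /eqP ox] | no_x] :=
    boolP [exists x in G, #[x] == p ^ b.+1].
    have oxp : #[x ^+ p] = p ^ b.
      by rewrite orderXdiv ox expnS ?dvdn_mulr // mulKn.
    have sxp : <[x ^+ p]> \subset G by rewrite cycle_subG groupX.
    have le_m : {in G, forall y, #[y] <= p ^ b.+1}.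
      by move=> y /le_ord[i lt_i ->]; rewrite leq_exp2l.
    have := psi_le_subgroup sxp le_m.
    rewrite [psi <[_]>]psi_cyclic ?cycle_cyclic // -!orderE !oxp oG.
    have := psi_Cyc_primepow b p_pr.
    have -> : p ^ (2 * b).+1 = p * (p ^ b) ^ 2.
      by rewrite -expnM -expnS mulnC.
    set d := psi _ => d_def.
    have -> : p ^ b.+2 - p ^ b = (p ^ 2 - 1) * p ^ b.
      by rewrite mulnBl mul1n -expnD.
    have -> : (p ^ 2 - 1) * p ^ b * p ^ b.+1 = (p ^ 2 - 1) * p * (p ^ b) ^ 2.
      by rewrite [p ^ b.+1]expnS; ring.
    move=> le_psi.
    have := ratio_pgroup_square p_gt1 _ c_def d_def largeG le_psi.
    rewrite -expnM expn_gt0 p_gt0 => /(_ isT) /eqP.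
    by rewrite -[1](expn0 p) eqn_exp2l // muln_eq0 orbF => /eqP.
  have le_m : {in G, forall y, #[y] <= p ^ b}.
    move=> y Gy; have [i lt_i oy] := le_ord y Gy; rewrite oy leq_exp2l //.
    have : i != b.+1; last by lia.
    apply: contra no_x => /eqP i_b.
    by apply/exists_inP; exists y; rewrite // oy i_b.
  have := psi_le le_m; rewrite oG.
  have -> : p ^ b.+2 * p ^ b = p ^ 2 * (p ^ b) ^ 2.
    by rewrite -expnM -!expnD; congr (_ ^ _); lia.
  rewrite leqNgt (ratio_pgroup_lt p_gt1 _ c_def largeG) //.
  by rewrite expn_gt0 Q_gt0.
have {}le_ord x : x \in G -> x ^+ p = 1%g.
  move=> Gx; apply/eqP; rewrite -order_dvdn.
  by have [i] := le_ord x Gx; rewrite b0 -{2}[p]expn1 => ? ->; apply: dvdn_exp2l.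
rewrite oG b0; split=> //; apply/abelemP => //; split=> //.
by apply: card_p2group_abelian p_pr _; rewrite oG b0.
Qed.

(** * A cyclic subgroup of small index *)

(** For p > q + 1 the mean of the orders exceeds n / p.  Otherwise q = 2 and
    p = 3, and psi(G) is at least 7 n^2 / 22.  If all indices of cyclic
    subgroups were at least 4, psi(G) would be at most n^2 / 4.  If the least
    one is 3, attained by <x>, the n / 6 elements of <x^2> have order at most
    n / 6 and the others at most n / 3, so that psi(G) is at most 11 n^2 / 36,
    which is still less than 7 n^2 / 22. *)
Lemma large_psi_cyclic_index gT (G : {group gT}) q p :
    prime q -> prime p -> q < p -> q %| #|G| ->
    (forall r, r \in \pi(#|G|) -> q <= r <= p) -> large_psi q G ->
  exists2 x, x \in G & #|G| < p * #[x].
Proof.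
move=> q_pr p_pr lt_qp q_G pi_G largeG.
have q_gt1 := prime_gt1 q_pr; have n_gt0 := cardG_gt0 G.
have lower : q * #|G| ^ 2 <= p.+1 * psi (Cyc #|G|).
  by apply: psi_Cyc_lower => //; lia.
apply/exists_inP; apply: contraLR largeG => /exists_inPn small.
have {}small x : x \in G -> p * #[x] <= #|G|.
  by move=> Gx; rewrite leqNgt small.
rewrite /large_psi -ltnNge.
have le_p_psi m : {in G, forall x, m * #[x] <= #|G|} -> m * psi G <= #|G| ^ 2.
  move=> le_m; rewrite /psi big_distrr -mulnn -sum_nat_const /=; exact: leq_sum.
have [le_qp | ] := leqP q.+2 p.
  rewrite ltnNge; apply/negP => largeG.
  have := ratio_mean_order q_gt1 le_qp n_gt0 lower largeG.
  by rewrite ltnNge le_p_psi.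
move=> le_pq; have p_def : p = q.+1 by lia.
have q2 : q = 2.
  case: (even_prime q_pr) => // odd_q.
  by case: (even_prime p_pr) => [|odd_p]; [lia | rewrite p_def /= odd_q in odd_p].
rewrite {p lt_qp le_pq p_pr pi_G}p_def {q q_pr q_gt1}q2 in q_G lower small *.
rewrite /ratio_num /ratio_den /=.
have [/exists_inP[x Gx /eqP ox] | no_x] :=
  boolP [exists x in G, 3 * #[x] == #|G|].
  have [m xm] : exists m, #[x] = 2 * m.
    move: q_G; rewrite -ox Gauss_dvdr // => /dvdnP[m ->].
    by exists m; rewrite mulnC.
  have ox2 : #[x ^+ 2] = m by rewrite orderXdiv xm ?dvdn_mulr // mulKn.
  have sx2 : <[x ^+ 2]> \subset G by rewrite cycle_subG groupX.
  have le_x : {in G, forall y, #[y] <= 2 * m}.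
    by move=> y Gy; rewrite -(leq_pmul2l (ltn0Sn 2)) -xm ox small.
  have := psi_le_subgroup sx2 le_x.
  have : psi <[x ^+ 2]> <= m * m.
    rewrite -{1}ox2 orderE; apply: psi_le => y /order_dvdG.
    by rewrite -orderE ox2 => /dvdn_leq -> //; rewrite -ox2 order_gt0.
  rewrite -orderE ox2; move: lower; rewrite -ox xm.
  have : 0 < m * m by rewrite muln_gt0 -ox2 order_gt0.
  have -> : 3 * (2 * m) - m = 5 * m by lia.
  move: (psi G) (psi <[_]>) (psi _) => s s' c; lia.
have : 4 * psi G <= #|G| ^ 2.
  apply: le_p_psi => x Gx; have /dvdnP[j oG] := order_dvdG Gx.
  have := small x Gx; rewrite oG !leq_pmul2r //.
  rewrite leq_eqVlt => /predU1P[j3|//]; case/exists_inP: no_x.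
  by exists x; rewrite // oG j3.
have : 0 < #|G| ^ 2 by rewrite expn_gt0 n_gt0.
move: lower; move: (_ ^ 2) (psi _) (psi _) => N c s; lia.
Qed.

(** The index of <x> is less than p, so <x> contains a Sylow p-subgroup P of G
    and, being abelian, normalises it: the number of conjugates of P is less
    than p, and congruent to 1 modulo p. *)
Lemma cyclic_normal_Sylow gT (G : {group gT}) p x :
    prime p -> x \in G -> #|G| < p * #[x] ->
  exists2 P : {group gT}, p.-Sylow(G) P & cyclic P /\ P <| G.
Proof.
move=> p_pr Gx lt_p; have sxG : <[x]> \subset G by rewrite cycle_subG.
have lt_index : #|G : <[x]>| < p.
  by rewrite -(ltn_pmul2r (order_gt0 x)) mulnC Lagrange // mulnC.
have [P sylP] := Sylow_exists p <[x]>.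
have sPx := pHall_sub sylP.
have sylPG : p.-Sylow(G) P.
  rewrite pHallE (subset_trans sPx sxG) (card_Hall sylP) -(Lagrange sxG).
  rewrite partnM ?cardG_gt0 ?indexg_gt0 // [X in _ * X]part_p'nat ?muln1 //=.
  rewrite p'natE //; apply: contraL lt_index => /dvdn_leq le_p.
  by rewrite -leqNgt le_p ?indexg_gt0.
exists P => //; split; first exact: cyclicS sPx (cycle_cyclic x).
have := card_Syl_mod G p_pr; rewrite (card_Syl sylPG) modn_small => [N1|].
  rewrite /normal (pHall_sub sylPG).
  by have /eqP := N1; rewrite indexg_eq1 subsetI => /andP[_ ->].
apply: leq_ltn_trans lt_index; apply: dvdn_leq; rewrite ?indexg_gt0 //.
apply: indexgS; rewrite subsetI sxG.
by apply: sub_abelian_norm sPx; exact: cycle_abelian.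
Qed.

(** * A cyclic normal Sylow subgroup *)

(** The conjugates of h under P are |P| in number and lie in the coset Ph, hence
    exhaust it. *)
Lemma order_mul_fixed_point_free gT (P : {group gT}) h u :
  h \in 'N(P) -> 'C_P[h] = 1%g -> u \in P -> #[u * h] = #[h].
Proof.
move=> nPh fpf Pu; pose f v := (h ^ v * h^-1)%g.
have inj_f : {in P &, injective f}.
  move=> v w Pv Pw /mulIg/(congr1 (conjg^~ w^-1%g)).
  rewrite -!conjgM mulgV conjg1 => /conjg_fixP/commgP cvw.
  have : (v * w^-1)%g \in 'C_P[h] by rewrite inE groupM ?groupV //=; apply/cent1P.
  by rewrite fpf inE -eq_mulgV1 => /eqP.
have sfP : f @: P \subset P.
  apply/subsetP=> _ /imsetP[v Pv ->].
  have -> : f v = (v^-1 * v ^ h^-1)%g by rewrite /f !conjgE invgK !mulgA.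
  by rewrite groupM ?groupV // memJ_norm ?groupV.
have /eqP fP : f @: P == P by rewrite eqEcard sfP (card_in_imset inj_f) leqnn.
have /imsetP[v Pv ->] : u \in f @: P by rewrite fP.
by rewrite /f mulgKV orderJ.
Qed.

(** By coprime action [P, h] meets C_P(h) trivially; as the subgroups of P form a
    chain, one of the two is trivial, and [P, h] is not. *)
Lemma cyclic_pgroup_fixed_point_free gT (P : {group gT}) h (p : nat) :
    p.-group P -> cyclic P -> h \in 'N(P) -> coprime #|P| #[h] ->
  h \notin 'C(P) -> 'C_P[h] = 1%g.
Proof.
move=> pP cycP nPh coPh not_cPh.
have nPH : <[h]> \subset 'N(P) by rewrite cycle_subG.
have cP := cyclic_abelian cycP.
have := coprime_abel_cent_TI nPH coPh cP; rewrite cent_cycle.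
have sRP : [~: P, <[h]>] \subset P by rewrite commg_subl.
have sCP : 'C_P[h] \subset P := subsetIl _ _.
have [a oR] := p_natP (pgroupS sRP pP); have [b oC] := p_natP (pgroupS sCP pP).
have [le_ab | /ltnW le_ba] := leqP a b.
  have : [~: P, <[h]>] \subset 'C_P[h].
    by rewrite -(cardSg_cyclic cycP) // oR oC dvdn_exp2l.
  rewrite subsetI => /andP[_ /setIidPl ->] /commG1P.
  by rewrite centsC cycle_subG => /idP; rewrite (negPf not_cPh).
have : 'C_P[h] \subset [~: P, <[h]>].
  by rewrite -(cardSg_cyclic cycP) // oR oC dvdn_exp2l.
by move=> sCR tiR; apply/trivgP; rewrite -tiR subsetI sCR subsetIr.
Qed.

(** The coset of P given by h in H contributes psi(P) times the order of h if h
    centralises P, and |P| times this order otherwise. *)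
Lemma psi_cyclic_pgroup_sdprod gT (G P H : {group gT}) (p : nat) :
    p.-group P -> cyclic P -> coprime #|P| #|H| -> P ><| H = G ->
  psi G = psi P * psi 'C_H(P) + #|P| * \sum_(h in H :\: 'C_H(P)) #[h].
Proof.
move=> pP cycP coPH defG; have [_ _ nPH _] := sdprodP defG.
rewrite (psi_sdprod defG) (bigID [in 'C(P)]) /=; congr (_ + _).
  rewrite /psi mulnC big_distrl /=.
  apply: eq_big => [h | h /andP[Hh cPh]]; first by rewrite inE.
  rewrite big_distrr /=; apply: eq_bigr => u Pu; rewrite mulnC; apply: orderM.
    exact: commute_sym (centP cPh u Pu).
  exact: coprime_dvdl (order_dvdG Pu) (coprime_dvdr (order_dvdG Hh) coPH).
rewrite big_distrr /=; apply: eq_big => [h | h /andP[Hh ncPh]].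
  by rewrite !inE; case: (h \in H); rewrite ?andbT //= andbF.
rewrite -sum_nat_const; apply: eq_bigr => u Pu.
have nPh := subsetP nPH h Hh.
apply: order_mul_fixed_point_free Pu => //.
apply: cyclic_pgroup_fixed_point_free pP _ _ _ _ => //.
exact: coprime_dvdr (order_dvdG Hh) coPH.
Qed.

Lemma psi_noncentral_cyclic_sdprod gT (G P H : {group gT}) p q :
    prime q -> prime p -> q < p -> p.-group P -> cyclic P -> cyclic H ->
    coprime #|P| #|H| ->
    (forall r, r \in \pi(#|H|) -> q <= r) ->
    P ><| H = G -> ~~ (H \subset 'C(P)) -> ~~ large_psi q G.
Proof.
move=> q_pr p_pr lt_qp pP cycP cycH coPH pi_q defG not_cHP.
have sCH : 'C_H(P) \subset H := subsetIl _ _.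
have prC : 'C_H(P) \proper H.
  by rewrite properE sCH; apply: contra not_cHP; rewrite subsetI => /andP[].
have ntP : P :!=: 1%g by apply: contra not_cHP => /eqP ->; rewrite cents1.
rewrite /large_psi -ltnNge -(sdprod_card defG) psi_Cyc_coprime // -!psi_cyclic //.
rewrite (psi_cyclic_pgroup_sdprod pP cycP coPH defG).
have leC := psi_proper_cyclic cycH prC pi_q.
have := psi_setD sCH; set S := \sum_(h in _) _ => psiH.
have le_BA := ltnW (card_lt_psi ntP).
have ratioP :=
  quotient_bound_mono lt_qp (card_le_psi_cyclic_pgroup p_pr pP cycP ntP).
have :=
  ratio_metacyclic (prime_gt1 q_pr) (psi_gt0 H) le_BA (psi_gt0 P) ratioP leC.
congr (_ * _ < _); rewrite psiH; move: le_BA => /subnK; move: (_ - _) => D <-.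
ring.
Qed.

(** * The groups attaining the bound *)

(** The internal form of (C_q x C_q) x C_k, which is easier to assemble in the
    induction than an isomorphism type. *)
Definition abelem2_times_cyclic q gT (G : {group gT}) :=
  exists A B : {group gT},
    [/\ A \x B = G, q.-abelem A, #|A| = q ^ 2, cyclic B & coprime q #|B|].

Lemma psi_abelem gT (A : {group gT}) q :
  q.-abelem A -> psi A = 1 + (#|A| - 1) * q.
Proof.
move=> abA; rewrite /psi (bigD1 1%g) //= order1; congr (_ + _).
rewrite (eq_bigr (fun=> q)) => [|x /andP[Ax ntx]]; last first.
  exact: abelem_order_p abA Ax ntx.
rewrite (cardsD1 1%g) group1 add1n subn1 -sum_nat_const.
by apply: eq_bigl => x; rewrite !inE andbC.
Qed.

Lemma psi_abelem2_times_cyclic q gT (G : {group gT}) :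
    prime q -> abelem2_times_cyclic q G ->
  ratio_num q * psi (Cyc #|G|) = ratio_den q * psi G.
Proof.
move=> q_pr [A [B [defG abA oA cycB coqB]]].
have coAB : coprime #|A| #|B| by rewrite oA coprimeXl.
rewrite (psi_dprod defG coAB) -(dprod_card defG) psi_Cyc_coprime // oA.
rewrite (psi_abelem abA) (psi_cyclic cycB) oA.
have := psi_Cyc_primepow 2 q_pr; rewrite /ratio_num /ratio_den.
move: (q ^ 2 - 1) => K.
rewrite [(2 * 2).+1]/=; move=> <-.
by move: (psi _) (psi _) => c d; ring.
Qed.

(** Induction on the order, splitting off the Sylow subgroup for the largest
    prime. *)
Lemma large_psi_noncyclic q gT (G : {group gT}) :
    prime q -> q %| #|G| -> (forall r, r \in \pi(#|G|) -> q <= r) ->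
    ~~ cyclic G -> large_psi q G ->
  abelem2_times_cyclic q G.
Proof.
move=> q_pr; have [n] := ubnP #|G|; elim: n => // n IHn in G *.
move=> /ltnSE-le_n q_G min_q ncG largeG.
have n_gt1 : 1 < #|G|.
  by rewrite cardG_gt1; apply: contra ncG => /eqP ->; exact: cyclic1.
set p := max_pdiv #|G|.
have max_p r : r \in \pi(#|G|) -> r <= p := @max_pdiv_max _ r.
have p_pi : p \in \pi(#|G|) by rewrite pi_max_pdiv.
have p_pr : prime p by move: p_pi; rewrite mem_primes => /andP[].
have := min_q p p_pi; rewrite leq_eqVlt => /predU1P[q_p | lt_qp].
  have qG : q.-group G.
    rewrite /pgroup; apply/pnatP=> // r r_pr r_G; rewrite inE /= eqn_leq.
    have r_pi : r \in \pi(#|G|) by rewrite mem_primes r_pr cardG_gt0.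
    by rewrite min_q // {1}q_p max_p.
  have [abG oG] := large_psi_pgroup q_pr qG ncG largeG.
  exists G, 1%G; split=> //; rewrite ?dprodg1 ?cyclic1 //.
  by rewrite cards1 coprimen1.
have [x Gx lt_x] : exists2 x, x \in G & #|G| < p * #[x].
  apply: large_psi_cyclic_index lt_qp q_G _ largeG => // r r_pi.
  by rewrite min_q // max_p.
have [P sylP [cycP nsPG]] := cyclic_normal_Sylow p_pr Gx lt_x.
have pP := pHall_pgroup sylP.
have /splitsP[H complH] := SchurZassenhaus_split (pHall_Hall sylP) nsPG.
have defG : P ><| H = G by apply/(sdprod_normal_complP nsPG); rewrite complgC.
have coPH : coprime #|P| #|H|.
  by rewrite (coprime_sdprod_Hall_l defG) (pHall_Hall sylP).
have ntP : P :!=: 1%g by rewrite -cardG_gt1 (card_Hall sylP) p_part_gt1.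
have sHG : H \subset G by case/sdprod_context: defG.
have min_qH r : r \in \pi(#|H|) -> q <= r.
  by move=> r_H; apply: min_q; apply: pi_of_dvd r_H; rewrite ?cardSg.
have dprodG : H \subset 'C(P) -> P \x H = G by move=> cPH; rewrite dprodEsd.
have coqP : coprime q #|P|.
  have [a ->] := p_natP pP; rewrite coprimeXr // prime_coprime //.
  by rewrite dvdn_prime2 // neq_ltn lt_qp.
have [cycH | ncH] := boolP (cyclic H).
  case: (boolP (H \subset 'C(P))) => [/dprodG defGd | not_cPH].
    by case/negP: ncG; rewrite (cyclic_dprod defGd).
  by case/negP: (psi_noncentral_cyclic_sdprod q_pr p_pr lt_qp pP cycP cycH
    coPH min_qH defG not_cPH).
move: largeG; rewrite /large_psi -(sdprod_card defG) psi_Cyc_coprime //.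
rewrite -(psi_cyclic cycP) (psi_cyclic_pgroup_sdprod pP cycP coPH defG).
have := psi_setD (subsetIl H 'C(P)); set S := \sum_(h in _) _ => psiH.
have lt_BA := card_lt_psi ntP => largeG.
have oPgt1 : 1 < #|P| by rewrite cardG_gt1.
have structH : abelem2_times_cyclic q H.
  apply: IHn => //.
  - by apply: leq_trans le_n; rewrite -(sdprod_card defG) ltn_Pmull.
  - by move: q_G; rewrite -(sdprod_card defG) Gauss_dvdr.
  rewrite /large_psi psiH -(leq_pmul2l (psi_gt0 P)).
  rewrite mulnCA; apply: leq_trans largeG _.
  by rewrite mulnCA leq_mul2l mulnDr leq_add2l leq_mul2r ltnW ?orbT.
have eqH := psi_abelem2_times_cyclic q_pr structH.
(* The bound for G is that for H times psi(P), weakened by the passage from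
   psi(P) to |P| on the part of H outside the centraliser, which must be empty. *)
have S0 : S = 0.
  have : ratio_den q * (psi P * S) <= ratio_den q * (#|P| * S).
    by move: largeG; rewrite mulnCA eqH mulnCA psiH !mulnDr leq_add2l.
  rewrite leq_pmul2l /ratio_den ?addn1 // leq_mul2r => /orP[/eqP //|].
  by rewrite leqNgt lt_BA.
have cPH : H \subset 'C(P).
  apply/subsetP=> h Hh; apply/idPn=> not_cPh.
  have Sh : h \in H :\: 'C_H(P) by rewrite !inE Hh (negPf not_cPh).
  by move/eqP: S0; rewrite /S (bigD1 h Sh) addn_eq0 eqn0Ngt order_gt0.
have [A [B [defH abA oA cycB coqB]]] := structH.
have [_ mulAB cAB tiAB] := dprodP defH.
have sBH : B \subset H by rewrite -mulAB mulG_subr.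
have cBP : P \subset 'C(B) by rewrite centsC (subset_trans sBH).
have coBP : coprime #|B| #|P| by rewrite coprime_sym (coprimegS sBH).
have cycBP : cyclic (B <*> P) by apply: cyclicY.
have defBP : B \x P = B <*> P by rewrite dprodEY // coprime_TIg.
exists A, (B <*> P)%G; split=> //.
  by rewrite /= -defBP dprodA defH dprodC dprodG.
by rewrite -(dprod_card defBP) coprimeMr coqB.
Qed.

(** The prime divisors of k are at least q, hence greater, while those of q! are
    at most q. *)
Lemma coprime_fact_pdiv n k q :
    0 < n -> prime q -> pdiv n = q -> k %| n -> coprime q k -> coprime k q`!.
Proof.
move=> n_gt0 q_pr q_n k_n coqk; apply: contraLR coqk => not_co.
have k_gt0 := dvdn_gt0 n_gt0 k_n.
have gcd_gt1 : 1 < gcdn k q`! by rewrite ltn_neqAle eq_sym not_co gcdn_gt0 k_gt0.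
set r := pdiv (gcdn k q`!); have r_pr : prime r := pdiv_prime gcd_gt1.
have : r %| gcdn k q`! := pdiv_dvd _; rewrite dvdn_gcd => /andP[r_k r_fact].
have le_qr : q <= r by rewrite -q_n pdiv_min_dvd ?prime_gt1 // (dvdn_trans r_k).
have le_rq : r <= q.
  move: r_fact; elim: (q) => [|m IHm]; first by rewrite fact0 Euclid_dvd1.
  rewrite factS Euclid_dvdM // => /orP[/dvdn_leq|/IHm/leqW] //; exact.
have -> : q = r by apply/eqP; rewrite eqn_leq le_qr.
by rewrite prime_coprime // r_k.
Qed.

Lemma abelem_setX_Cyc q :
  prime q -> q.-abelem (setX (Cyc q) (Cyc q)).
Proof.
move=> q_pr; have [iso1 iso2] := isog_setX_trivial (Cyc q) (Cyc q).
rewrite (dprod_abelem q (setX_dprod (Cyc q) (Cyc q))).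
rewrite -(isog_abelem iso1) -(isog_abelem iso2) andbb.
by apply: prime_abelem => //; rewrite card_Zp ?prime_gt0.
Qed.

Lemma abelem2_times_cyclicP q gT (G : {group gT}) : prime q ->
  abelem2_times_cyclic q G <->
  exists k, [/\ 0 < k, #|G| = q ^ 2 * k, coprime q k
    & G \isog setX (setX (Cyc q) (Cyc q)) (Cyc k)].
Proof.
move=> q_pr; have q_gt0 := prime_gt0 q_pr.
have abX := abelem_setX_Cyc q_pr.
have oX : #|setX (Cyc q) (Cyc q)| = q ^ 2 by rewrite cardsX card_Zp.
split=> [[A [B [defG abA oA cycB coqB]]] | [k [k_gt0 oG coqk isoG]]].
  have [iso1 iso2] := isog_setX_trivial (setX (Cyc q) (Cyc q))%G (Cyc #|B|).
  exists #|B|; split=> //; first by rewrite -(dprod_card defG) oA.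
  apply: isog_dprod defG (setX_dprod _ _) _ _.
    by apply: isog_trans iso1; rewrite (isog_abelem_card _ abA) abX oX oA /=.
  by apply: isog_trans iso2; rewrite isog_cyclic_card // cyclic_Cyc card_Zp /=.
have [iso1 iso2] := isog_setX_trivial (setX (Cyc q) (Cyc q))%G (Cyc k).
move: isoG; rewrite isog_sym => /isogP[f injf defG].
have defX := setX_dprod (setX (Cyc q) (Cyc q))%G (Cyc k).
pose A := setX_group (setX_group (Cyc q) (Cyc q)) (1%G : {group 'Z_k}).
pose B := setX_group (1%G : {group 'Z_q * 'Z_q}) (Cyc k).
have sAX : A \subset setX (setX (Cyc q) (Cyc q)) (Cyc k).
  by rewrite -(dprodW defX) mulG_subl.
have sBX : B \subset setX (setX (Cyc q) (Cyc q)) (Cyc k).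
  by rewrite -(dprodW defX) mulG_subr.
exists (f @* A)%G, (f @* B)%G; split=> /=.
- by rewrite (injm_dprod _ injf defX) ?defG.
- by rewrite injm_abelem // -(isog_abelem iso1).
- by rewrite card_injm // -(card_isog iso1).
- by rewrite injm_cyclic // -(isog_cyclic iso2) cyclic_Cyc.
by rewrite card_injm // -(card_isog iso2) card_Zp.
Qed.

End SumsOfOrders.

(** * The criterion *)

Lemma fratioE q :
  fratio q.+1%:R = ((ratio_num q.+1)%:R / (ratio_den q.+1)%:R)%R.
Proof.
rewrite /fratio /ratio_num /ratio_den !(GRing.natrD, GRing.natrM, GRing.natrX).
by rewrite GRing.natrB ?expn_gt0 // GRing.natrX.
Qed.

Lemma second_maximal_qstarE q gT (G : {group gT}) :
    (0 < q)%N -> qstar_group q G ->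
  second_maximal_qstar q G <->
    (ratio_num q * psi (Cyc #|G|) = ratio_den q * psi G)%N.
Proof.
case: q => // q _ G_q; rewrite /second_maximal_qstar fratioE.
have den_n0 : ((ratio_den q.+1)%:R != 0 :> rat)%R.
  by rewrite Num.Theory.pnatr_eq0 /ratio_den addn1.
rewrite GRing.mulrAC -GRing.natrM; split=> [[_ eq_psi] | eq_psi].
  have /eqP := congr1 (fun x => x * (ratio_den q.+1)%:R)%R eq_psi.
  rewrite GRing.divfK // -GRing.natrM Num.Theory.eqr_nat => /eqP <-.
  by rewrite mulnC.
by split=> //; rewrite eq_psi GRing.natrM GRing.mulrAC GRing.divff // GRing.mul1r.
Qed.

Theorem theorem5 (q n : nat) (gT : finGroupType) (G : {group gT})
    (q_prime : prime q) (G_qstar : qstar_group q G) (G_order : #|G| = n) :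
  second_maximal_qstar q G <->
  exists k : nat,
    [/\ (0 < k)%N, n = (q ^ 2 * k)%N, coprime k q`!
      & G \isog setX (setX (Cyc q) (Cyc q)) (Cyc k)].
Proof.
have q_G : q %| #|G| by rewrite -[X in X %| _]G_qstar pdiv_dvd.
have min_q r : r \in \pi(#|G|) -> q <= r.
  rewrite mem_primes => /and3P[r_pr _ r_G].
  by rewrite -[X in X <= _]G_qstar pdiv_min_dvd ?prime_gt1.
have structE := abelem2_times_cyclicP G q_prime.
rewrite (second_maximal_qstarE (prime_gt0 q_prime) G_qstar) -G_order.
split=> [eq_psi | [k [k_gt0 oG cokq isoG]]]; last first.
  apply: psi_abelem2_times_cyclic => //; apply/structE; exists k; split=> //.
  by rewrite coprime_sym (coprime_dvdr _ cokq) // dvdn_fact // prime_gt0 /=.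
have [cycG | ncG] := boolP (cyclic G).
  (* psi(G) = psi(C_n) would give f(q) = 1. *)
  case/negP: (negbT (ltn_eqF (ratio_num_lt_den (prime_gt1 q_prime)))).
  by rewrite -(eqn_pmul2r (psi_gt0 G)) {1}(psi_cyclic cycG) eq_psi.
have largeG : large_psi q G by rewrite /large_psi eq_psi.
have [k [k_gt0 oG coqk isoG]] :=
  structE.1 (large_psi_noncyclic q_prime q_G min_q ncG largeG).
exists k; split=> //.
apply: (coprime_fact_pdiv (cardG_gt0 G) q_prime G_qstar) => //.
by rewrite oG dvdn_mull.
Qed.
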